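(* Let $A^{(2)}$ be the $2$-times convolution matrix of $\mathbb{F}_2^n$, let $M_D$ be the adjacency matrix of the subspace hypergraph $\mathcal{D}_n$, and let $f:\mathbb{F}_2^n\to\mathbb{C}$. Then for all $x\in\mathbb{F}_2^n$ $$(A^{(2)}\circ f)(x)=6\,(M_D\circ f)(x)+3\Big(\sum_{y\ne x}f(y)^2\Big)f(x)+(\mathbb{I}\circ f)(x).$$
   Context: The $2$-times convolution matrix $A^{(2)}=(a_{x,y,z,v})$ of $\mathbb{F}_2^n$ is the $4$-dimensional array indexed by $x,y,z,v\in\mathbb{F}_2^n$ with $a_{x,y,z,v}=1$ if $x=y+z+v$ and $0$ otherwise. The subspace hypergraph $\mathcal{D}_n$ is the $4$-uniform hypergraph with vertex set $\mathbb{F}_2^n$ whose hyperedges are the $4$-element sets $\{x,y,z,v\}$ (of distinct vectors) with $x+y+z+v=\overline 0$. Its adjacency matrix $M_D$ is the $4$-dimensional array indexed by quadruples of vertices with entry $\frac{1}{3!}$ at $(x,y,z,v)$ if $\{x,y,z,v\}$ is a hyperedge and $0$ otherwise. For a $4$-dimensional matrix $B=(b_{x,y,z,v})$ indexed by a finite set $X$ and $f:X\to\mathbb{C}$, $(B\circ f)(x)=\sum_{y,z,v\in X}b_{x,y,z,v}f(y)f(z)f(v)$. $\mathbb{I}$ is the $4$-dimensional identity matrix (entry $1$ when all four indices coincide, $0$ otherwise), so $(\mathbb{I}\circ f)(x)=f(x)^3$. *)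

(* Defs.v *)
From mathcomp Require Export all_boot all_order all_algebra.
From mathcomp Require Export reals.
From mathcomp.real_closed Require Export complex.

Set Implicit Arguments.
Unset Strict Implicit.
Unset Printing Implicit Defensive.

Import GRing.Theory.
Local Open Scope ring_scope.

(* 4-dimensional matrices over K with all four indices ranging over X. *)
Definition matrix4 (X K : Type) : Type := X -> X -> X -> X -> K.

Definition circ4 (X : finType) (K : fieldType) (B : matrix4 X K) (f : X -> K)
    (x : X) : K :=
  \sum_(y : X) \sum_(z : X) \sum_(v : X) B x y z v * f y * f z * f v.

Definition id4 (X : eqType) (K : fieldType) : matrix4 X K :=
  fun x y z v => if [&& x == y, y == z & z == v] then 1 else 0.

Definition conv4 (n : nat) (K : fieldType) : matrix4 'rV['F_2]_n K :=
  fun x y z v => if x == y + z + v then 1 else 0.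

(* A hypergraph on the vertex set X is given by its set of hyperedges. *)
Definition subspace_hypergraph (n : nat) : {set {set 'rV['F_2]_n}} :=
  [set e : {set 'rV['F_2]_n} | (#|e| == 4) && (\sum_(u in e) u == 0)].

(* Adjacency matrix of a 4-uniform hypergraph E. When all hyperedges have
   exactly 4 elements, [set x; y; z; v] \in E forces the four indices to be
   pairwise distinct. *)
Definition adjacency4 (X : finType) (K : fieldType) (E : {set {set X}}) :
    matrix4 X K :=
  fun x y z v => if [set x; y; z; v] \in E then ((3`!)%:R)^-1 else 0.

Arguments id4 : clear implicits.
Arguments conv4 : clear implicits.
Arguments adjacency4 {X} K E.

(* Main.v *)
Require Import Defs.
Import GRing.Theory.
Local Open Scope ring_scope.
Local Open Scope complex_scope.

(** The identity already holds entry by entry. Consider the quadruples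
    [(x, y, z, v)] with [x = y + z + v], that is, with [x + y + z + v = 0].
    If the four vectors are distinct, they form a hyperedge. Otherwise two of
    them coincide and cancel in characteristic 2, which forces the other two to
    coincide as well: either all four are equal, or [x] equals exactly one of
    [y], [z], [v] and the remaining two are equal to each other. So the
    convolution matrix is a sum of five arrays with disjoint supports
    ([conv4_decomp]): the hyperedge indicator [6 * adjacency4], the identity,
    and three arrays [pairing4] that differ only by a permutation of the last
    three indices.

    Applying [circ4], which is linear in the matrix and invariant under such
    permutations, gives the result, since each pairing array contributes
    [(\sum_(y | y != x) f y ^+ 2) * f x] ([circ4_pairing4]). The scalars enter
    only through the inverse of [3`!], so [circ4_conv4] is over any field in
    which 6 is nonzero. *)

(** * Linearity and symmetry of the product with a function *)

Section Circ4.
Variables (X : finType) (K : fieldType).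
Implicit Types (B C : matrix4 X K) (f : X -> K) (x : X).

Lemma eq_circ4 B C f x :
  (forall y z v, B x y z v = C x y z v) -> circ4 B f x = circ4 C f x.
Proof.
move=> eqBC; rewrite /circ4; apply: eq_bigr => y _; apply: eq_bigr => z _.
by apply: eq_bigr => v _; rewrite eqBC.
Qed.

Lemma circ4D B C f x :
  circ4 (fun x y z v => B x y z v + C x y z v) f x = circ4 B f x + circ4 C f x.
Proof.
rewrite /circ4 -big_split; apply: eq_bigr => y _ /=.
rewrite -big_split; apply: eq_bigr => z _ /=.
by rewrite -big_split; apply: eq_bigr => v _ /=; rewrite !mulrDl.
Qed.

Lemma circ4Z a B f x :
  circ4 (fun x y z v => a * B x y z v) f x = a * circ4 B f x.
Proof.
rewrite /circ4 mulr_sumr; apply: eq_bigr => y _.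
rewrite mulr_sumr; apply: eq_bigr => z _.
by rewrite mulr_sumr; apply: eq_bigr => v _; rewrite !mulrA.
Qed.

Lemma circ4_swap_yz B f x :
  circ4 (fun x y z v => B x z y v) f x = circ4 B f x.
Proof.
rewrite /circ4 exchange_big; apply: eq_bigr => y _; apply: eq_bigr => z _.
by apply: eq_bigr => v _; rewrite -[B _ _ _ _ * _ * _]mulrA [f z * _]mulrC mulrA.
Qed.

Lemma circ4_swap_zv B f x :
  circ4 (fun x y z v => B x y v z) f x = circ4 B f x.
Proof.
rewrite /circ4; apply: eq_bigr => y _; rewrite exchange_big.
by apply: eq_bigr => z _; apply: eq_bigr => v _; rewrite mulrAC.
Qed.

End Circ4.

(** * Quadruples made of two distinct pairs *)

Definition pairing4 (X : eqType) (K : fieldType) : matrix4 X K :=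
  fun x y z v => if [&& x == y, z == v & z != x] then 1 else 0.

Arguments pairing4 : clear implicits.

Lemma circ4_pairing4 (X : finType) (K : fieldType) (f : X -> K) (x : X) :
  circ4 (pairing4 X K) f x = (\sum_(y | y != x) f y ^+ 2) * f x.
Proof.
rewrite /circ4 (bigD1 x) //= [X in _ + X]big1 ?addr0 => [|y neq_yx].
  rewrite mulr_suml [RHS]big_mkcond; apply: eq_bigr => z _ /=.
  rewrite (bigD1 z) //= big1 => [|v neq_vz].
    rewrite /pairing4 !eqxx /= addr0; case: ifP => _; last by rewrite !mul0r.
    by rewrite mul1r -mulrA mulrC.
  by rewrite /pairing4 [z == v]eq_sym (negPf neq_vz) andbF !mul0r.
apply: big1 => z _; apply: big1 => v _.
by rewrite /pairing4 eq_sym (negPf neq_yx) !mul0r.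
Qed.

(** * Vectors over the field with two elements *)

Section F2Space.
Variable n : nat.
Implicit Types (x y z v : 'rV['F_2]_n).

Lemma addvv_F2 x : x + x = 0.
Proof. by rewrite -mulr2n -scaler_nat (_ : 2%:R = 0) ?scale0r //; exact/eqP. Qed.

Lemma oppv_F2 x : - x = x.
Proof. by apply/eqP; rewrite -subr_eq0 -opprD addvv_F2 oppr0. Qed.

Lemma addv_eq0_F2 x y : (x + y == 0) = (x == y).
Proof. by rewrite addr_eq0 oppv_F2. Qed.

Lemma addv_addv_F2 x y : x + (x + y) = y.
Proof. by rewrite addrA addvv_F2 add0r. Qed.

(** A set [[set x; y; z; v]] with a repetition has fewer than four elements, so
    distinctness of the four entries comes from the cardinality condition. *)
Lemma mem_subspace_hypergraph x y z v :
  ([set x; y; z; v] \in subspace_hypergraph n) =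
  uniq [:: x; y; z; v] && (x == y + z + v).
Proof.
have defS : [set x; y; z; v] =i [:: x; y; z; v].
  by move=> u; rewrite !inE -!orbA.
have -> : [set x; y; z; v] \in subspace_hypergraph n =
    (#|[set x; y; z; v]| == 4) && (\sum_(u in [set x; y; z; v]) u == 0).
  by rewrite inE.
rewrite (eq_card defS) (_ : (_ == 4) = uniq [:: x; y; z; v]); last first.
  by apply/eqP/card_uniqP.
case: (boolP (uniq _)) => //= Us.
rewrite (eq_bigl _ _ defS) -big_uniq //= !big_cons big_nil addr0.
by rewrite addv_eq0_F2 addrA.
Qed.

Lemma conv4_decomp (K : fieldType) x y z v : 6%:R != 0 :> K ->
  conv4 n K x y z v =
    6%:R * adjacency4 K (subspace_hypergraph n) x y z v
    + (pairing4 _ K x y z v + pairing4 _ K x z y v + pairing4 _ K x v y z)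
    + id4 _ K x y z v.
Proof.
move=> nz6; rewrite /conv4 /adjacency4 /pairing4 /id4 mem_subspace_hypergraph.
rewrite /= !inE.
(* When [x] equals one of [y], [z], [v], it cancels and the sum condition
   becomes the equality of the other two. *)
have eq_cancel (a b : 'rV['F_2]_n) : (x == x + a + b) = (a == b).
  by rewrite -addv_eq0_F2 -addrA addv_addv_F2 addv_eq0_F2.
have [<-|neq_xy] := eqVneq x y.
  rewrite eq_cancel /= mulr0 add0r.
  have [<-|neq_zv] := eqVneq z v; last by rewrite !andbF !addr0.
  by rewrite !andbT !andbF eq_sym; case: eqP => _; rewrite !(addr0, add0r).
have [<-|neq_xz] := eqVneq x z.
  rewrite (addrC y x) eq_cancel /= mulr0 add0r !andbT.
  by rewrite (eq_sym y x) (negPf neq_xy) andbF !(addr0, add0r).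
have [<-|neq_xv] := eqVneq x v.
  rewrite addrC addrA eq_cancel /= mulr0 andbT.
  by rewrite !(addr0, add0r).
rewrite /= !addr0 andbT.
(* As [x] differs from the other three, a repetition among these makes the sum
   condition fail: it would force [x] to equal the third. *)
have [<-|_] := eqVneq y z.
  by rewrite addvv_F2 add0r (negPf neq_xv) mulr0.
have [<-|_] := eqVneq y v.
  by rewrite addrC addv_addv_F2 (negPf neq_xz) mulr0.
have [<-|_] := eqVneq z v.
  by rewrite -addrA addvv_F2 addr0 (negPf neq_xy) mulr0.
by case: ifP => _; rewrite ?mulr0 ?mulfV.
Qed.

Lemma circ4_conv4 (K : fieldType) (f : 'rV['F_2]_n -> K) x :
  6%:R != 0 :> K ->
  circ4 (conv4 n K) f x =
    6%:R * circ4 (adjacency4 K (subspace_hypergraph n)) f x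
    + 3%:R * (\sum_(y | y != x) f y ^+ 2) * f x
    + circ4 (id4 _ K) f x.
Proof.
move=> nz6.
transitivity (circ4 (fun x y z v =>
    6%:R * adjacency4 K (subspace_hypergraph n) x y z v
    + (pairing4 _ K x y z v + pairing4 _ K x z y v + pairing4 _ K x v y z)
    + id4 _ K x y z v) f x).
  by apply: eq_circ4 => y z v; apply: conv4_decomp.
rewrite !circ4D circ4Z.
rewrite (circ4_swap_zv _ _ (fun x y z v => pairing4 _ _ x z y v)).
rewrite !(circ4_swap_yz _ _ (pairing4 _ _)) circ4_pairing4 -mulrA.
by congr (_ + _ + _); rewrite -mulr2n -mulrSr mulr_natl.
Qed.

End F2Space.

Theorem proposition6 (R : realType) (n : nat) (f : 'rV['F_2]_n -> R[i])
    (x : 'rV['F_2]_n) :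
  circ4 (conv4 n R[i]) f x =
    6%:R * circ4 (adjacency4 R[i] (subspace_hypergraph n)) f x
    + 3%:R * (\sum_(y : 'rV['F_2]_n | y != x) f y ^+ 2) * f x
    + circ4 (id4 'rV['F_2]_n R[i]) f x.
Proof. by apply: circ4_conv4; rewrite Num.Theory.pnatr_eq0. Qed.
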